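(* Let $n\ge 1$, $\hbar>0$, and let $\theta=(\theta^{ij})$ be a constant real antisymmetric $n\times n$ matrix. For two phase space functions $A_1(x,p)$ and $A_2(x,p)$ on $\mathbb{R}^n\times\mathbb{R}^n$, and a proper function $B(x)$ on $\mathbb{R}^n$, the following equality holds: $$\int d^n y\,\Big\{ A_1(x,p)*A_2(x,p) * B(x) * e^{i y\cdot p}\Big\} = \int d^n y\,\Big\{A_1(x,-i\hbar\tfrac{\partial}{\partial x}) *_{\theta}A_2(x,-i\hbar\tfrac{\partial}{\partial x}) *_{\theta} B(x)\Big\} * e^{i y\cdot p},$$ where $A_1(x,-i\hbar\frac{\partial}{\partial x}) *_{\theta}A_2(x,-i\hbar\frac{\partial}{\partial x}) *_{\theta} B$ denotes the successive application $A_1(x,-i\hbar\frac{\partial}{\partial x}) *_{\theta}\big(A_2(x,-i\hbar\frac{\partial}{\partial x}) *_{\theta} B\big)$, and the differential operators do not act outside the curly bracket.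
   Context: ''Phase space functions'' and ''proper function'' carry no further specification: no particular function class is fixed. The functions are those for which the Fourier representations, star products and integrals written here are meaningful, and the identity is a formal one obtained by Fourier superposition of exponentials. Notation: $k\cdot x=\sum_i k_i x^i$ and $\theta(k,k')=\sum_{i,j}\theta^{ij}k_ik'_j$. For $A$ on $\mathbb{R}^{2n}$, $\tilde A(k,l)=\int d^nx\,d^np\, e^{-ik\cdot x-il\cdot p}A(x,p)$; for $B$ on $\mathbb{R}^n$, $\tilde B(k)=\int d^nx\, e^{-ik\cdot x}B(x)$. Star product: on exponentials $$e^{ik\cdot x+il\cdot p} * e^{ik'\cdot x+il'\cdot p}=e^{-\frac{i\hbar}{2}(k\cdot l'-k'\cdot l)}\,e^{-\frac{i}{2}\theta(k,k')}\,e^{i(k+k')\cdot x+i(l+l')\cdot p},$$ extended bilinearly by Fourier superposition; the product is associative. In particular, for $y\in\mathbb{R}^n$, $C*e^{iy\cdot p}=e^{iy\cdot p}\,C(x-\tfrac{\hbar}{2}y,p)$ (also when $C$ depends on $x$ only). The product $*_\theta$ is obtained from $*$ by setting $\hbar=0$. Weyl-ordered operator: $$A(x,-i\hbar\tfrac{\partial}{\partial x})*_\theta B(x)=\frac{1}{(2\pi)^{3n}}\int \tilde A(k,l)\tilde B(k')\,e^{i\hbar\, l\cdot(k'+\frac12 k)}\,e^{-\frac i2\theta(k,k')}\,e^{i(k+k')\cdot x}\,d^nk\,d^nl\,d^nk',$$ i.e. the Fourier superposition of $e^{ik\cdot x+il\cdot(-i\hbar\partial_x)}*_\theta e^{ik'\cdot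 x}$ with $e^{ik\cdot x+\hbar l\cdot\partial_x}=e^{ik\cdot x}e^{\frac{i\hbar}{2}k\cdot l}e^{\hbar l\cdot\partial_x}$ and $e^{ik\cdot x}*_\theta e^{ik'\cdot x}=e^{-\frac i2\theta(k,k')}e^{i(k+k')\cdot x}$. *)

(* Defs.v *)
From HB Require Import structures.
From mathcomp Require Import all_boot all_order all_algebra.
From mathcomp Require Import all_classical all_reals all_analysis.
From mathcomp Require Import complex.
Set Implicit Arguments.
Unset Strict Implicit.
Unset Printing Implicit Defensive.
Import Order.TTheory GRing.Theory Num.Theory.
Import numFieldNormedType.Exports.
Local Open Scope classical_set_scope.
Local Open Scope ring_scope.

(* The product measure of the library, with its sigma-finiteness, which is not
   inferred for [m1 \x m2] itself. *)
Section prod_measure.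
Context d1 d2 (T1 : measurableType d1) (T2 : measurableType d2) (R : realType).
Variables (m1 : {sigma_finite_measure set T1 -> \bar R})
  (m2 : {sigma_finite_measure set T2 -> \bar R}).

Definition prod_measure : set (T1 * T2) -> \bar R := (m1 \x m2)%E.

HB.instance Definition _ := Measure.on prod_measure.

Let prod_measure_sigma_finite : sigma_finite setT prod_measure.
Proof.
have /sigma_finiteP[F [TF ndF Foo]] := sigma_finiteT m1.
have /sigma_finiteP[G [TG ndG Goo]] := sigma_finiteT m2.
exists (fun n => F n `*` G n).
  rewrite -setXTT TF TG predeqE => -[x y]; split.
    move=> [/= [n _ Fnx] [k _ Gky]]; exists (maxn n k) => //; split.
    - by move: x Fnx; exact/subsetPset/ndF/leq_maxl.
    - by move: y Gky; exact/subsetPset/ndG/leq_maxr.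
  by move=> [n _ []/= ? ?]; split; exists n.
move=> k; have [? ?] := Foo k; have [? ?] := Goo k.
split; first exact: measurableX.
rewrite /prod_measure product_measure1E// lte_mul_pinfty//.
by rewrite ge0_fin_numE.
Qed.

HB.instance Definition _ := Measure_isSigmaFinite.Build _ _ _ prod_measure
  prod_measure_sigma_finite.

End prod_measure.

(* lebesgue_measure lives on the alias measurableTypeR R of R. *)
Notation vec R n := (n.-tuple (measurableTypeR R)) (only parsing).
Notation phase R n :=
  (n.-tuple (measurableTypeR R) * n.-tuple (measurableTypeR R))%type
  (only parsing).

Section lebesgue_vec.
Context {R : realType}.

Section cons_measure.
Variables (n : nat) (m : {sigma_finite_measure set (vec R n) -> \bar R}).

Let cons_vec (z : measurableTypeR R * vec R n) : vec R n.+1 :=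
  [tuple of z.1 :: z.2].

Let measurable_cons_vec : measurable_fun [set: _] cons_vec.
Proof. exact: measurable_cons. Qed.

Definition cons_measure : set (vec R n.+1) -> \bar R :=
  pushforward (prod_measure (@lebesgue_measure R) m)
    (fun z : measurableTypeR R * vec R n => [tuple of z.1 :: z.2]).

Let cons_measure0 : cons_measure set0 = 0%E.
Proof. by rewrite /cons_measure /pushforward preimage_set0 measure0. Qed.

Let cons_measure_ge0 A : (0 <= cons_measure A)%E.
Proof. exact: measure_ge0. Qed.

Let cons_measure_sigma_additive : semi_sigma_additive cons_measure.
Proof.
move=> F mF tF mUF; rewrite /cons_measure /pushforward preimage_bigcup.
apply: measure_semi_sigma_additive.
- by move=> k; rewrite -[X in measurable X]setTI; exact: measurable_cons_vec.
- apply/trivIsetP => /= i j _ _ ij; rewrite -preimage_setI.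
  by move/trivIsetP : tF => /(_ _ _ _ _ ij) ->//; rewrite preimage_set0.
- rewrite -preimage_bigcup -[X in measurable X]setTI.
  exact: measurable_cons_vec.
Qed.

HB.instance Definition _ := isMeasure.Build _ _ _ cons_measure
  cons_measure0 cons_measure_ge0 cons_measure_sigma_additive.

Let cons_measure_sigma_finite : sigma_finite setT cons_measure.
Proof.
have [F TF Foo] := sigma_finiteT (prod_measure (@lebesgue_measure R) m).
pose u (v : vec R n.+1) : measurableTypeR R * vec R n :=
  (tnth v ord0, [tuple of behead v]).
have mu : measurable_fun [set: vec R n.+1] u.
  apply/measurable_fun_pair; first exact: measurable_tnth.
  exact: measurable_behead.
have uK z : u (cons_vec z) = z.
  by case: z => a b; congr pair; exact: val_inj.
exists (fun k => u @^-1` F k).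
  by rewrite -preimage_bigcup -TF preimage_setT.
move=> k; have [mF Fk] := Foo k; split.
  by rewrite -[X in measurable X]setTI; exact: mu.
rewrite /cons_measure /pushforward -comp_preimage.
by rewrite (_ : u \o _ = id) //; apply/funext => z; exact: uK.
Qed.

HB.instance Definition _ := Measure_isSigmaFinite.Build _ _ _ cons_measure
  cons_measure_sigma_finite.

End cons_measure.

Fixpoint lebesgue_vec (n : nat) : {sigma_finite_measure set (vec R n) -> \bar R} :=
  match n with
  | 0 => \d_([tuple] : vec R 0)
  | m.+1 => cons_measure (lebesgue_vec m)
  end.

End lebesgue_vec.

Section star_product.
Context {R : realType} {n : nat}.
Local Notation C := R[i].
Implicit Types (k l x y : vec R n) (q z : phase R n).
Implicit Types (A : phase R n -> C) (B : vec R n -> C).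

Local Notation dx := (@lebesgue_vec R n).
Local Notation dxp := (prod_measure (@lebesgue_vec R n) (@lebesgue_vec R n)).

Definition cintegral d (T : measurableType d) (mu : {measure set T -> \bar R})
    (f : T -> C) : C :=
  Complex (\int[mu]_t complex.Re (f t)) (\int[mu]_t complex.Im (f t)).

Definition cintegrable d (T : measurableType d)
    (mu : {measure set T -> \bar R}) (f : T -> C) : Prop :=
  mu.-integrable setT (fun t => (complex.Re (f t))%:E) /\
  mu.-integrable setT (fun t => (complex.Im (f t))%:E).

Definition expi (t : R) : C := Complex (cos t) (sin t).

Definition vec0 : vec R n := [tuple 0 | i < n].
Definition vadd k l : vec R n := [tuple tnth k i + tnth l i | i < n].
Definition dot k x : R := \sum_(i < n) tnth k i * tnth x i.
Definition thetaf (theta : 'M[R]_n) k l : R :=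
  \sum_(i < n) \sum_(j < n) theta i j * tnth k i * tnth l j.

Definition fnorm (m : nat) : C := (real_complex R (2 * pi)) ^- m.

Definition wave_x k x : C := expi (dot k x).
Definition wave q z : C := expi (dot q.1 z.1 + dot q.2 z.2).

Definition fourier_x B k : C :=
  cintegral dx (fun x => expi (- dot k x) * B x).
Definition fourier A q : C :=
  cintegral dxp (fun z => expi (- dot q.1 z.1 - dot q.2 z.2) * A z).

(* The functions with a meaningful Fourier representation: both Fourier
   integrals converge absolutely, and the function is the superposition of
   exponentials given by its transform.  These classes are stable under all the
   products below, so that every integral below converges absolutely. *)
Definition fourier_representable_x B : Prop :=
  [/\ cintegrable dx B, cintegrable dx (fourier_x B) &
      forall x, B x =
        fnorm n * cintegral dx (fun k => fourier_x B k * wave_x k x)].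
Definition fourier_representable A : Prop :=
  [/\ cintegrable dxp A, cintegrable dxp (fourier A) &
      forall z, A z =
        fnorm (2 * n)%N * cintegral dxp (fun q => fourier A q * wave q z)].

Variables (hbar : R) (theta : 'M[R]_n).

Definition wave_star q q' z : C :=
  expi (- (hbar / 2) * (dot q.1 q'.2 - dot q'.1 q.2)) *
  expi (- (1 / 2) * thetaf theta q.1 q'.1) *
  wave (vadd q.1 q'.1, vadd q.2 q'.2) z.

(* The star product is the bilinear extension of wave_star.  The superposition
   of wave q is over all q for a phase space function, over the q = (k, 0)
   for a function of x only, and reduces to q = (0, y) for e^{i y . p}; hence
   one formula for each kind of factors. *)
Definition star A1 A2 z : C :=
  fnorm (4 * n)%N * cintegral (prod_measure dxp dxp)
    (fun t => fourier A1 t.1 * fourier A2 t.2 * wave_star t.1 t.2 z).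

Definition star_x A B z : C :=
  fnorm (3 * n)%N * cintegral (prod_measure dxp dx)
    (fun t => fourier A t.1 * fourier_x B t.2 * wave_star t.1 (t.2, vec0) z).

Definition star_exp A y z : C :=
  fnorm (2 * n)%N * cintegral dxp
    (fun q => fourier A q * wave_star q (vec0, y) z).

Definition star_x_exp B y z : C :=
  fnorm n * cintegral dx
    (fun k => fourier_x B k * wave_star (k, vec0) (vec0, y) z).

(* A(x, - i hbar d/dx) *_theta B for the Weyl ordering, with t = ((k, l), k') *)
Definition weyl_star A B x : C :=
  fnorm (3 * n)%N * cintegral (prod_measure dxp dx)
    (fun t => fourier A t.1 * fourier_x B t.2 *
       expi (hbar * (dot t.1.2 t.2 + 1 / 2 * dot t.1.2 t.1.1)) *
       expi (- (1 / 2) * thetaf theta t.1.1 t.2) *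
       wave_x (vadd t.1.1 t.2) x).

End star_product.

(* Main.v *)
(* Writing one factor f as a superposition of exponentials turns every product
   into a superposition of phase-space translates (the Bopp shift): with
   T_q f (z) = e^{i (psi q + <iota q, z>)} f (z + sigma q), each product is
   \int w(q) T_q f dq, where the weight w is the Fourier transform of the other
   factor.  Since w and f are absolutely integrable, Tonelli and translation
   invariance show that such a superposition is again representable, with
   Fourier transform
     Q |-> \int w(q) e^{i (psi q + <Q - iota q, sigma q>)} f^(Q - iota q) dq,
   so that no general Fourier inversion theorem is required.
   For A = A1 * A2, both sides are integrals over y of
   e^{i y.p} F(x - hbar y / 2), with F = (A * B)(., p) on the left and F the
   Weyl-ordered action of A on B on the right; up to the same factor each is the
   Fourier transform of F at 2 p / hbar, and the two transforms have equal
   integrands.  Finally the Weyl-ordered action is multiplicative, because the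
   operators T_q compose up to the phase defining the star product. *)
Require Import Defs.
From mathcomp Require Import all_boot all_order all_algebra.
From mathcomp Require Import all_classical all_reals all_analysis.
From mathcomp Require Import measurable_realfun complex ring lra.
Import Order.TTheory GRing.Theory Num.Theory.
Import numFieldNormedType.Exports.
Local Open Scope classical_set_scope.
Local Open Scope ring_scope.
Set Implicit Arguments.
Unset Strict Implicit.
Unset Printing Implicit Defensive.

(** * Complex-valued integrals *)

Section complex_integral.
Context {R : realType}.
Local Notation C := R[i].

(* Submultiplicative, like the modulus, but without square roots. *)
Definition norm1 (c : C) : R := `|complex.Re c| + `|complex.Im c|.

Lemma norm1_ge0 c : 0 <= norm1 c.
Proof. by rewrite addr_ge0. Qed.

Lemma ReM (a b : C) : complex.Re (a * b) =
  complex.Re a * complex.Re b - complex.Im a * complex.Im b.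
Proof. by case: a b => [? ?] []. Qed.

Lemma ImM (a b : C) : complex.Im (a * b) =
  complex.Re a * complex.Im b + complex.Im a * complex.Re b.
Proof. by case: a b => [? ?] []. Qed.

Lemma norm1M a b : norm1 (a * b) <= norm1 a * norm1 b.
Proof.
rewrite /norm1 ReM ImM mulrDl !mulrDr -!normrM.
have := ler_normB (complex.Re a * complex.Re b) (complex.Im a * complex.Im b).
have := ler_normD (complex.Re a * complex.Im b) (complex.Im a * complex.Re b).
lra.
Qed.

Lemma norm1_expi t : norm1 (expi t) <= 2.
Proof.
by rewrite /norm1 /= (_ : 2 = 1 + 1) ?lerD ?cos_max ?sin_max// -natr1.
Qed.

Lemma expiD s t : expi (s + t) = expi s * expi t :> C.
Proof.
by rewrite /expi cosD sinD; congr Complex; rewrite addrC mulrC [X in _ + X]mulrC.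
Qed.

Definition cmeasurable d (T : measurableType d) (f : T -> C) :=
  measurable_fun setT (fun t => complex.Re (f t)) /\
  measurable_fun setT (fun t => complex.Im (f t)).

Section measurability.
Context d (T : measurableType d).
Implicit Types f g : T -> C.

Lemma cmeasurable_cst c : cmeasurable (fun _ : T => c).
Proof. by split; exact: measurable_cst. Qed.

Lemma cmeasurableM f g : cmeasurable f -> cmeasurable g ->
  cmeasurable (fun t => f t * g t).
Proof.
move=> [fr fi] [gr gi]; split.
- under eq_fun do rewrite ReM.
  by apply: measurable_funB; exact: measurable_funM.
- under eq_fun do rewrite ImM.
  by apply: measurable_funD; exact: measurable_funM.
Qed.

Lemma cmeasurable_expi (h : T -> R) :
  measurable_fun setT h -> cmeasurable (fun t => expi (h t)).
Proof.
by move=> mh; split=> /=; apply: measurableT_comp => //;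
  apply: continuous_measurable_fun; [exact: continuous_cos|exact: continuous_sin].
Qed.

Lemma cmeasurable_comp d' (T' : measurableType d') (f : T' -> C) (h : T -> T') :
  cmeasurable f -> measurable_fun setT h -> cmeasurable (fun t => f (h t)).
Proof.
move=> [fr fi] mh.
by split; [exact: (measurableT_comp fr)|exact: (measurableT_comp fi)].
Qed.

Lemma measurable_norm1 f : cmeasurable f ->
  measurable_fun setT (fun t => norm1 (f t)).
Proof. by case=> fr fi; apply: measurable_funD; apply: measurableT_comp. Qed.

End measurability.

(** * Absolute integrability of complex functions *)

Section integrability.
Context d (T : measurableType d) (mu : {measure set T -> \bar R}).
Implicit Types f g : T -> C.

Lemma cintegrable_cmeasurable f : cintegrable mu f -> cmeasurable f.
Proof.
by move=> [/measurable_int/measurable_EFinP ? /measurable_int/measurable_EFinP].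
Qed.

(** [norm1] dominates both parts and is the sum of their absolute values. A single nonnegative
    integral thus controls convergence, which is the form Tonelli needs. *)
Lemma cintegrableP f : cintegrable mu f <->
  cmeasurable f /\ (\int[mu]_t (norm1 (f t))%:E < +oo)%E.
Proof.
split=> [If|[mf foo]].
  split; first exact: cintegrable_cmeasurable If.
  have [Ir Ii] := If.
  under eq_integral do rewrite EFinD -2!abse_EFin.
  have [/integrableP[mr r1] /integrableP[mi i1]] := If.
  rewrite ge0_integralD//; last 2 first.
    exact: measurableT_comp.
    exact: measurableT_comp.
  by rewrite lte_add_pinfty.
have [fr fi] := mf; have /measurable_EFinP mN := measurable_norm1 mf.
split; apply/integrableP; (split; first exact/measurable_EFinP);
  apply: le_lt_trans foo; apply: ge0_le_integral => //;
  try by [exact/measurableT_comp/measurable_EFinP | exact/measurable_EFinP/measurable_norm1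
         | move=> x _; rewrite lee_fin norm1_ge0
         | move=> x _; rewrite /= lee_fin /norm1 ?lerDl ?lerDr].
Qed.

Lemma cintegrable_le f g (M : R) : cmeasurable f -> cintegrable mu g ->
  (forall t, norm1 (f t) <= M * norm1 (g t)) -> cintegrable mu f.
Proof.
move=> mf Ig fg; have [mg goo] := (cintegrableP g).1 Ig.
(* The sign of [M] is not prescribed; its absolute value is a nonnegative constant that can be
   pulled out of an extended integral. *)
have fg' t : norm1 (f t) <= `|M| * norm1 (g t).
  by rewrite (le_trans (fg t))// ler_wpM2r ?norm1_ge0// ler_norm.
apply/cintegrableP; split => //.
have := measurable_norm1 mf; have := measurable_norm1 mg.
move=> /measurable_EFinP m1 /measurable_EFinP m2.
apply: (@le_lt_trans _ _ (\int[mu]_t (`|M|%:E * (norm1 (g t))%:E))%E).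
  apply: ge0_le_integral => //=.
  - by move=> x _; rewrite lee_fin norm1_ge0.
  - exact: measurable_funeM.
  - by move=> x _; rewrite -EFinM lee_fin.
rewrite ge0_integralZl//; last by move=> x _; rewrite lee_fin norm1_ge0.
by rewrite lte_mul_pinfty// lee_fin.
Qed.

Lemma cintegrableMr f (u : T -> C) M : cintegrable mu f -> cmeasurable u ->
  (forall t, norm1 (u t) <= M) -> cintegrable mu (fun t => u t * f t).
Proof.
move=> If mu' uM; apply: (@cintegrable_le _ f M) => //.
  by apply: cmeasurableM => //; exact: cintegrable_cmeasurable If.
move=> t; apply: le_trans (norm1M _ _) _.
by rewrite ler_wpM2r ?norm1_ge0.
Qed.

Lemma cintegrableZ f (c : C) : cintegrable mu f ->
  cintegrable mu (fun t => c * f t).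
Proof.
by move=> If; apply: (@cintegrableMr _ (fun=> c) (norm1 c)) => //;
  exact: cmeasurable_cst.
Qed.

Lemma eq_cintegral f g : (forall t, f t = g t) ->
  cintegral mu f = cintegral mu g.
Proof. by move=> fg; congr cintegral; apply/funext. Qed.

Lemma cintegralZ f (c : C) : cintegrable mu f ->
  cintegral mu (fun t => c * f t) = c * cintegral mu f.
Proof.
move=> [Ir Ii]; rewrite /cintegral.
under eq_Rintegral do rewrite ReM.
under [in X in Complex _ X]eq_Rintegral do rewrite ImM.
have IZ (a : R) (g : T -> R) : mu.-integrable setT (fun t => (g t)%:E) ->
    mu.-integrable setT (fun t => (a * g t)%:E).
  by move=> Ig; apply: (@integrableZl _ _ _ mu setT measurableT a (EFin \o g)).
rewrite RintegralB ?RintegralD//; [|exact: IZ..].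
rewrite !RintegralZl//.
by case: c.
Qed.

Lemma norm1_cintegral f : cintegrable mu f ->
  norm1 (cintegral mu f) <= \int[mu]_t norm1 (f t).
Proof.
move=> If; have [Ir Ii] := If.
rewrite /norm1 /=.
apply: (@le_trans _ _ (\int[mu]_t `|complex.Re (f t)| + \int[mu]_t `|complex.Im (f t)|)).
  by rewrite lerD// le_normr_Rintegral.
rewrite -RintegralD//; last 2 first.
- exact: (integrable_norm Ir).
- exact: (integrable_norm Ii).
Qed.

End integrability.

(** * Fubini and Tonelli for complex integrands *)

Section fubini.
Context d1 d2 (T1 : measurableType d1) (T2 : measurableType d2).
Variables (m1 : {sigma_finite_measure set T1 -> \bar R})
  (m2 : {sigma_finite_measure set T2 -> \bar R}).
Implicit Types F : T1 * T2 -> C.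

(** The inner extended integral is finite only almost everywhere. The real-valued one agrees with it
    there and takes a default value elsewhere, so both have the same outer integral. *)
Let RF (g : T1 * T2 -> R) :
  (prod_measure m1 m2).-integrable setT (fun t => (g t)%:E) ->
  m1.-integrable setT (fun x => (\int[m2]_y g (x, y))%:E) /\
  \int[prod_measure m1 m2]_t g t = \int[m1]_x \int[m2]_y g (x, y).
Proof.
move=> Ig.
have I1 := integrable_fubini_F Ig.
have ae1 : ae_eq m1 setT (fubini_F m2 (fun t => (g t)%:E))
    (fun x => (\int[m2]_y g (x, y))%:E).
  have := integrable_ae measurableT I1; apply: filterS => x /(_ I) fx _.
  by rewrite /Rintegral fineK.
have mg : measurable_fun setT (fun x => (\int[m2]_y g (x, y))%:E).
  apply/measurable_EFinP; apply: measurableT_comp => //.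
  exact: measurable_int I1.
split.
  apply/integrableP; split => //.
  case/integrableP: I1 => mF; apply: le_lt_trans.
  rewrite le_eqVlt (ae_eq_integral (fun x => `|fubini_F m2 (fun t => (g t)%:E) x|)%E) ?eqxx//.
  - by apply: measurableT_comp.
  - by apply: measurableT_comp.
  - by apply: filterS ae1 => x xE Dx; rewrite xE.
rewrite /Rintegral; congr fine.
rewrite -/(Rintegral _ _ _) -(ae_eq_integral _ _ _ _ _ ae1)//; last exact: measurable_int I1.
by rewrite (integral12_prod_meas1 Ig).
Qed.

Lemma cfubini1 F : cintegrable (prod_measure m1 m2) F ->
  cintegral (prod_measure m1 m2) F =
  cintegral m1 (fun x => cintegral m2 (fun y => F (x, y))).
Proof. by move=> [/RF[_ Er] /RF[_ Ei]]; rewrite /cintegral Er Ei. Qed.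

Lemma cintegrable_fubini1 F : cintegrable (prod_measure m1 m2) F ->
  cintegrable m1 (fun x => cintegral m2 (fun y => F (x, y))).
Proof. by move=> [/RF[Ir _] /RF[Ii _]]; split. Qed.

End fubini.

(** Tonelli turns the integral of [norm1] over either product into the same iterated integral. *)
Lemma cintegrable_swap d1 d2 (T1 : measurableType d1) (T2 : measurableType d2)
  (m1 : {sigma_finite_measure set T1 -> \bar R})
  (m2 : {sigma_finite_measure set T2 -> \bar R}) (F : T1 * T2 -> C) :
  cintegrable (prod_measure m1 m2) F ->
  cintegrable (prod_measure m2 m1) (fun t => F (t.2, t.1)).
Proof.
move=> /cintegrableP[mF Foo]; apply/cintegrableP.
have mG : cmeasurable (fun t : T2 * T1 => F (t.2, t.1)).
  by apply: (cmeasurable_comp mF); exact: measurable_swap.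
split => //; have /measurable_EFinP mNF := measurable_norm1 mF.
have /measurable_EFinP mNG := measurable_norm1 mG.
apply: le_lt_trans Foo; rewrite le_eqVlt; apply/orP; left; apply/eqP.
rewrite [RHS](@fubini_tonelli1 _ _ _ _ _ m1 m2 (fun t => (norm1 (F t))%:E))//; last first.
  by move=> x; rewrite lee_fin norm1_ge0.
rewrite (@fubini_tonelli2 _ _ _ _ _ m2 m1 (fun t => (norm1 (F (t.2, t.1)))%:E))//.
by move=> x; rewrite lee_fin norm1_ge0.
Qed.

Lemma cintegral_prodC d1 d2 (T1 : measurableType d1) (T2 : measurableType d2)
  (m1 : {sigma_finite_measure set T1 -> \bar R})
  (m2 : {sigma_finite_measure set T2 -> \bar R}) (F : T1 * T2 -> C) :
  cintegrable (prod_measure m1 m2) F ->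
  cintegral (prod_measure m1 m2) F =
  cintegral (prod_measure m2 m1) (fun t => F (t.2, t.1)).
Proof.
move=> IF; have [Ir Ii] := IF; have [Ir' Ii'] := cintegrable_swap IF.
rewrite /cintegral /Rintegral; congr (Complex (fine _) (fine _)).
  by rewrite -(integral21_prod_meas1 Ir) -(integral12_prod_meas1 Ir').
by rewrite -(integral21_prod_meas1 Ii) -(integral12_prod_meas1 Ii').
Qed.

Lemma cintegral_exchange d1 d2 (T1 : measurableType d1) (T2 : measurableType d2)
  (m1 : {sigma_finite_measure set T1 -> \bar R})
  (m2 : {sigma_finite_measure set T2 -> \bar R}) (F : T1 * T2 -> C) :
  cintegrable (prod_measure m1 m2) F ->
  cintegral m1 (fun x => cintegral m2 (fun y => F (x, y))) =
  cintegral m2 (fun y => cintegral m1 (fun x => F (x, y))).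
Proof.
move=> IF; rewrite -(cfubini1 IF) (cintegral_prodC IF) cfubini1//.
exact: cintegrable_swap.
Qed.

End complex_integral.

(** * Superpositions of translates *)

(** Common interface of $\mathbb{R}^n$ and of phase space, so that the calculus of translates is
    developed once. Invariance is stated for nonnegative functions, as it is applied inside
    Tonelli. *)
Record fourier_space (R : realType) d (T : measurableType d)
    (mu : set T -> \bar R) (add : T -> T -> T) (opp : T -> T)
    (dotp : T -> T -> R) : Prop := FourierSpace {
  measurable_add : measurable_fun setT (fun t : T * T => add t.1 t.2) ;
  measurable_opp : measurable_fun setT opp ;
  measurable_pair : measurable_fun setT (fun t : T * T => dotp t.1 t.2) ;
  addvK : forall z a, add (add z a) (opp a) = z ;
  pairDl : forall q r z, dotp (add q r) z = dotp q z + dotp r z ;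
  pairDr : forall q z a, dotp q (add z a) = dotp q z + dotp q a ;
  pairNl : forall q z, dotp (opp q) z = - dotp q z ;
  ge0_integral_shift : forall a (f : T -> \bar R), measurable_fun setT f ->
    (forall t, (0 <= f t)%E) ->
    (\int[mu]_t f (add t a) = \int[mu]_t f t)%E }.

Section twist.
Context {R : realType}.
Local Notation C := R[i].
Context d (T : measurableType d) (mu : {sigma_finite_measure set T -> \bar R}).
Variables (add : T -> T -> T) (opp : T -> T) (dotp : T -> T -> R).
Hypothesis FS : fourier_space mu add opp dotp.

Definition ft (f : T -> C) (q : T) : C :=
  cintegral mu (fun z => expi (- dotp q z) * f z).

(** The constant [c] of the inversion formula stays abstract: it is [fnorm n] on positions and
    [fnorm (2 * n)] on phase space. *)
Definition representable (c : C) (f : T -> C) : Prop :=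
  [/\ cintegrable mu f, cintegrable mu (ft f) &
      forall z, f z = c * cintegral mu (fun q => ft f q * expi (dotp q z))].

Lemma measurable_add_comp d0 (X : measurableType d0) (a b : X -> T) :
  measurable_fun setT a -> measurable_fun setT b ->
  measurable_fun setT (fun x => add (a x) (b x)).
Proof.
move=> ma mb; apply: (measurableT_comp (g := fun x => (a x, b x)) (measurable_add FS)).
exact: measurable_fun_pair.
Qed.

Lemma measurable_pair_comp d0 (X : measurableType d0) (a b : X -> T) :
  measurable_fun setT a -> measurable_fun setT b ->
  measurable_fun setT (fun x => dotp (a x) (b x)).
Proof.
move=> ma mb; apply: (measurableT_comp (g := fun x => (a x, b x)) (measurable_pair FS)).
exact: measurable_fun_pair.
Qed.

Let measurable_shift a : measurable_fun setT (add^~ a).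
Proof. exact: measurable_add_comp. Qed.

Let Rintegral_shift (g : T -> R) a : measurable_fun setT g ->
  \int[mu]_t g (add t a) = \int[mu]_t g t.
Proof.
move=> /measurable_EFinP mg; rewrite /Rintegral; congr fine.
rewrite integralE [RHS]integralE.
under eq_integral do rewrite (funepos_comp (EFin \o g) (add^~ a)).
under [X in (_ - X)%E]eq_integral do rewrite (funeneg_comp (EFin \o g) (add^~ a)).
congr (_ - _)%E.
  by apply: (ge0_integral_shift FS a (measurable_funepos mg)) => t; exact: funepos_ge0.
by apply: (ge0_integral_shift FS a (measurable_funeneg mg)) => t; exact: funeneg_ge0.
Qed.

Lemma cintegral_shift (f : T -> C) a : cmeasurable f ->
  cintegral mu (fun t => f (add t a)) = cintegral mu f.
Proof.
by move=> [fr fi]; rewrite /cintegral (Rintegral_shift _ fr) (Rintegral_shift _ fi).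
Qed.

Lemma cintegrable_shift (f : T -> C) a : cintegrable mu f ->
  cintegrable mu (fun t => f (add t a)).
Proof.
move=> /cintegrableP[mf foo]; apply/cintegrableP; split.
  exact: (cmeasurable_comp mf).
have /measurable_EFinP mN := measurable_norm1 mf.
rewrite (ge0_integral_shift FS a mN)// => t.
by rewrite lee_fin norm1_ge0.
Qed.

Lemma cintegrable_expi (f : T -> C) (h : T -> R) : measurable_fun setT h ->
  cintegrable mu f -> cintegrable mu (fun t => expi (h t) * f t).
Proof.
move=> mh If; apply: (cintegrableMr If) => [|t]; last exact: norm1_expi.
exact: cmeasurable_expi.
Qed.

Let measurable_pairl z : measurable_fun setT (dotp^~ z).
Proof. exact: (measurable_pair_comp (a := id) (b := fun=> z)). Qed.

Let measurable_pairr q : measurable_fun setT (dotp q).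
Proof. exact: (measurable_pair_comp (a := fun=> q) (b := id)). Qed.

(** A phase costs at most a factor 2 in [norm1], so the bound is uniform in [h]. Applied to the
    inversion formula and to the transform, it bounds [f] and [ft f]. *)
Lemma norm1_oscillatory_integral (g : T -> C) (h : T -> R) :
  cintegrable mu g -> measurable_fun setT h ->
  norm1 (cintegral mu (fun t => expi (h t) * g t)) <= \int[mu]_t (2 * norm1 (g t)).
Proof.
move=> Ig mh.
have norm1I g' : cintegrable mu g' -> mu.-integrable setT (fun t => (norm1 (g' t))%:E).
  move=> [/integrable_norm I1 /integrable_norm I2].
  exact: (integrableD measurableT I1 I2).
have Ie := cintegrable_expi mh Ig.
apply: le_trans (norm1_cintegral Ie) _; apply: le_Rintegral => //.
- exact: norm1I.
- apply: (@integrableZl _ _ _ mu setT measurableT 2 (EFin \o (fun q => norm1 (g q)))).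
  exact: norm1I.
- move=> q _; apply: le_trans (norm1M _ _) _.
  by rewrite ler_wpM2r ?norm1_ge0 ?norm1_expi.
Qed.

Lemma representable_bounded c f : representable c f ->
  exists M, forall z, norm1 (f z) <= M.
Proof.
move=> [If Ig fE]; exists (norm1 c * \int[mu]_q (2 * norm1 (ft f q))) => z.
rewrite fE; apply: le_trans (norm1M _ _) _; rewrite ler_wpM2l ?norm1_ge0//.
by under eq_cintegral do rewrite mulrC; exact: norm1_oscillatory_integral.
Qed.

Lemma ft_bounded f : cintegrable mu f -> exists M, forall q, norm1 (ft f q) <= M.
Proof.
move=> If; exists (\int[mu]_z (2 * norm1 (f z))) => q.
by apply: norm1_oscillatory_integral => //; exact: measurable_funN.
Qed.

Context d' (S : measurableType d') (nu : {sigma_finite_measure set S -> \bar R}).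

(** By Tonelli, integrating over [T] first: translation invariance makes the inner integral of
    [norm1] independent of [s], and what remains is the product of the $L^1$ norms of [w] and [f].
    The factor [u] stands for bounded phases. *)
Lemma cintegrable_prod_shift (w : S -> C) (f : T -> C) (sigma : S -> T)
    (u : T * S -> C) M :
  cintegrable nu w -> cintegrable mu f -> measurable_fun setT sigma ->
  cmeasurable u -> (forall t, norm1 (u t) <= M) ->
  cintegrable (prod_measure mu nu)
    (fun t => u t * (w t.2 * f (add t.1 (sigma t.2)))).
Proof.
move=> Iw If ms mu' uM; apply: cintegrableMr mu' uM.
have [mw woo] := (cintegrableP _ _).1 Iw.
have [mf foo] := (cintegrableP _ _).1 If.
have mws : cmeasurable (fun t : T * S => w t.2).
  exact: (cmeasurable_comp mw).
have mfs : cmeasurable (fun t : T * S => f (add t.1 (sigma t.2))).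
  apply: (cmeasurable_comp mf).
  apply: measurable_add_comp => //; exact: measurableT_comp.
have mwf := cmeasurableM mws mfs.
apply/cintegrableP; split => //.
have n1w := measurable_norm1 mws; have n1f := measurable_norm1 mfs.
have n1wf := measurable_funM n1w n1f.
apply: (@le_lt_trans _ _ (\int[prod_measure mu nu]_t
    (norm1 (w t.2) * norm1 (f (add t.1 (sigma t.2))))%:E)%E).
  apply: ge0_le_integral => //.
  - by move=> t _; rewrite lee_fin norm1_ge0.
  - exact/measurable_EFinP/measurable_norm1.
  - exact/measurable_EFinP.
  - by move=> t _; rewrite lee_fin norm1M.
rewrite (@fubini_tonelli2 _ _ _ _ _ mu nu
    (fun t => (norm1 (w t.2) * norm1 (f (add t.1 (sigma t.2))))%:E))//; first last.
- by move=> t; rewrite lee_fin mulr_ge0 ?norm1_ge0.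
- exact/measurable_EFinP.
have /measurable_EFinP n1f0 := measurable_norm1 mf.
have /measurable_EFinP n1w0 := measurable_norm1 mw.
rewrite /fubini_G /=.
under eq_integral => s _.
  under eq_integral do rewrite EFinM.
  rewrite ge0_integralZl//; [|exact: measurableT_comp n1f0 _
    |by move=> t _; rewrite lee_fin norm1_ge0|by rewrite lee_fin norm1_ge0].
  rewrite (ge0_integral_shift FS _ n1f0)//; last by move=> t; rewrite lee_fin norm1_ge0.
  over.
have f0 : (0 <= \int[mu]_t (norm1 (f t))%:E)%E.
  by apply: integral_ge0 => t _; rewrite lee_fin norm1_ge0.
rewrite ge0_integralZr//; last by move=> t _; rewrite lee_fin norm1_ge0.
have w0 : (0 <= \int[nu]_s (norm1 (w s))%:E)%E.
  by apply: integral_ge0 => t _; rewrite lee_fin norm1_ge0.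
by rewrite lte_mul_pinfty ?ge0_fin_numE.
Qed.

Variables (c : C) (f : T -> C) (w : S -> C).
Variables (psi : S -> R) (iota sigma : S -> T).
Hypotheses (repf : representable c f) (Iw : cintegrable nu w).
Hypotheses (mpsi : measurable_fun setT psi) (miota : measurable_fun setT iota)
  (msigma : measurable_fun setT sigma).

(** Each [s] contributes a constant phase [psi s], a frequency [iota s] and a displacement
    [sigma s], with amplitude [w s]. *)
Definition twist (z : T) : C :=
  cintegral nu (fun s => w s * expi (psi s + dotp (iota s) z) * f (add z (sigma s))).

Let If : cintegrable mu f. Proof. by case: repf. Qed.
Let Ift : cintegrable mu (ft f). Proof. by case: repf. Qed.

Let measurable_phase (h : T * S -> R) :
  measurable_fun setT h ->
  cmeasurable (fun t : T * S => expi (psi t.2 + h t)).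
Proof.
move=> mh; apply: cmeasurable_expi; apply: measurable_funD => //.
exact: (measurableT_comp mpsi measurable_snd).
Qed.

Let twist_prod : cintegrable (prod_measure mu nu) (fun t =>
  w t.2 * expi (psi t.2 + dotp (iota t.2) t.1) * f (add t.1 (sigma t.2))).
Proof.
under eq_fun do rewrite (mulrC (w _)) -mulrA.
apply: cintegrable_prod_shift Iw If msigma _ _ => [|t]; last exact: norm1_expi.
apply: measurable_phase; apply: measurable_pair_comp => //.
exact: measurableT_comp.
Qed.

(** Fubini would give integrability in [s] for almost every point only; a bounded [g] against the
    integrable weight gives it at every point. *)
Let weight_bounded (g : T -> C) (h : S -> R) (tau : S -> T) M :
  cmeasurable g -> (forall t, norm1 (g t) <= M) ->
  measurable_fun setT h -> measurable_fun setT tau ->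
  cintegrable nu (fun s => w s * expi (h s) * g (tau s)).
Proof.
move=> mg gM mh mtau.
under eq_fun do rewrite mulrC (mulrC (w _)) mulrA.
apply: (cintegrableMr Iw (M := M * 2)).
  by apply: cmeasurableM; [exact: (cmeasurable_comp mg)|exact: cmeasurable_expi].
move=> s; apply: le_trans (norm1M _ _) _.
by rewrite ler_pM ?norm1_ge0 ?norm1_expi.
Qed.

Let twist_integrand z : cintegrable nu (fun s =>
  w s * expi (psi s + dotp (iota s) z) * f (add z (sigma s))).
Proof.
have [M fM] := representable_bounded repf.
apply: weight_bounded (cintegrable_cmeasurable If) fM _ _.
  apply: measurable_funD => //.
  exact: (measurable_pair_comp miota (measurable_cst z)).
exact: measurable_add_comp.
Qed.

Let ft_twist_integrand Q : cintegrable nu (fun s =>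
  w s * expi (psi s + dotp (add Q (opp (iota s))) (sigma s)) *
  ft f (add Q (opp (iota s)))).
Proof.
have [M fM] := ft_bounded If.
have mio : measurable_fun setT (fun s => add Q (opp (iota s))).
  apply: measurable_add_comp => //.
  exact: (measurableT_comp (measurable_opp FS) miota).
apply: weight_bounded (cintegrable_cmeasurable Ift) fM _ (mio).
apply: measurable_funD => //; exact: (measurable_pair_comp mio msigma).
Qed.

Lemma cintegrable_twist : cintegrable mu twist.
Proof. exact: (cintegrable_fubini1 twist_prod). Qed.

Lemma ft_twist Q : ft twist Q = cintegral nu (fun s =>
  w s * expi (psi s + dotp (add Q (opp (iota s))) (sigma s)) *
  ft f (add Q (opp (iota s)))).
Proof.
rewrite /ft /twist.
under eq_cintegral do rewrite -(cintegralZ _ (twist_integrand _)).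
rewrite (@cintegral_exchange _ _ _ _ _ mu nu (fun t => expi (- dotp Q t.1) *
   (w t.2 * expi (psi t.2 + dotp (iota t.2) t.1) * f (add t.1 (sigma t.2))))); last first.
  apply: (cintegrableMr twist_prod (M := 2)) => [|t]; last exact: norm1_expi.
  apply: cmeasurable_expi; apply: measurable_funN.
  exact: (measurable_pair_comp (measurable_cst Q)).
apply: eq_cintegral => s.
set q := add Q (opp (iota s)).
have Iq : cintegrable mu (fun z => expi (- dotp q z) * f z).
  by by apply: cintegrable_expi => //; exact: measurable_funN.
(* With [q] for $Q - \iota(s)$, the transform of [f] at [q] is written in the variable $z +
   \sigma(s)$. The leftover phase is $\langle q, \sigma(s)\rangle$. *)
rewrite -(cintegral_shift (sigma s) (cintegrable_cmeasurable Iq)).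
rewrite -cintegralZ; last exact: (cintegrable_shift (sigma s) Iq).
apply: eq_cintegral => z /=.
have phaseE : expi (- dotp Q z) * expi (psi s + dotp (iota s) z) =
    expi (psi s + dotp q (sigma s)) * expi (- dotp q (add z (sigma s))) :> C.
  by rewrite -!expiD; congr expi; rewrite /q (pairDr FS) !(pairDl FS) !(pairNl FS); ring.
transitivity (w s * f (add z (sigma s)) *
  (expi (- dotp Q z) * expi (psi s + dotp (iota s) z))); first by ring.
by rewrite phaseE; ring.
Qed.

(** The translated function is now [ft f], displaced by [opp (iota s)]. The extra factor [u] is 1
    for integrability of the transform and $c\,e^{i\langle Q, z\rangle}$ for inversion. *)
Let ft_twist_prod (u : T * S -> C) M : cmeasurable u -> (forall t, norm1 (u t) <= M) ->
  cintegrable (prod_measure mu nu) (fun t => u t *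
    (w t.2 * expi (psi t.2 + dotp (add t.1 (opp (iota t.2))) (sigma t.2)) *
     ft f (add t.1 (opp (iota t.2))))).
Proof.
move=> mu' u2.
have mio : measurable_fun setT (fun s => opp (iota s)).
  exact: (measurableT_comp (measurable_opp FS) miota).
under eq_fun do rewrite (mulrC (w _)) -(mulrA (expi _)) mulrA.
apply: (cintegrable_prod_shift (M := M * 2) Iw Ift mio) => [|t].
  apply: cmeasurableM => //; apply: measurable_phase; apply: measurable_pair_comp => //.
    apply: measurable_add_comp => //.
    exact: (measurableT_comp mio measurable_snd).
  exact: (measurableT_comp msigma measurable_snd).
apply: le_trans (norm1M _ _) _.
by rewrite ler_pM ?norm1_ge0 ?norm1_expi.
Qed.

Lemma cintegrable_ft_twist : cintegrable mu (ft twist).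
Proof.
rewrite (funext ft_twist).
have := @ft_twist_prod (fun=> 1) _ (cmeasurable_cst _ _) (fun=> lexx _).
by under eq_fun do rewrite mul1r; move/cintegrable_fubini1.
Qed.

Let cintegrable_ft_expi (h : T -> R) : measurable_fun setT h ->
  cintegrable mu (fun q => ft f q * expi (h q)).
Proof. by move=> mh; under eq_fun do rewrite mulrC; exact: cintegrable_expi. Qed.

(** Inversion is inherited from [f]: after exchanging the integrals, the integral over [Q] is for
    each [s] the inversion formula of [f] at $z + \sigma(s)$, up to a phase and a translation by
    $\iota(s)$. *)
Lemma twist_representable : representable c twist.
Proof.
split; [exact: cintegrable_twist|exact: cintegrable_ft_twist|move=> z].
have mez : cmeasurable (fun Q => c * expi (dotp Q z)).
  by apply: cmeasurableM; [exact: cmeasurable_cst|exact: cmeasurable_expi].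
rewrite -cintegralZ; last first.
  by under eq_fun do rewrite mulrC; apply: cintegrable_expi => //;
    exact: cintegrable_ft_twist.
under [RHS]eq_cintegral => Q.
  rewrite ft_twist mulrCA mulrC -cintegralZ//.
  over.
rewrite (@cintegral_exchange _ _ _ _ _ mu nu (fun t => c * expi (dotp t.1 z) *
  (w t.2 * expi (psi t.2 + dotp (add t.1 (opp (iota t.2))) (sigma t.2)) *
     ft f (add t.1 (opp (iota t.2)))))); last first.
  apply: (ft_twist_prod (M := norm1 c * 2)) => [|t].
    apply: (cmeasurable_comp (f := fun Q => c * expi (dotp Q z)) mez).
    exact: measurable_fst.
  by apply: le_trans (norm1M _ _) _; rewrite ler_wpM2l ?norm1_ge0 ?norm1_expi.
case: repf => _ _ fE; apply: eq_cintegral => s; rewrite fE.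
have Ig := cintegrable_ft_expi (measurable_pairl (add z (sigma s))).
rewrite -(cintegral_shift (opp (iota s)) (cintegrable_cmeasurable Ig)).
rewrite mulrA -cintegralZ; last exact: (cintegrable_shift (opp (iota s)) Ig).
apply: eq_cintegral => Q /=.
set q := add Q (opp (iota s)).
have phaseE : expi (psi s + dotp (iota s) z) * expi (dotp q (add z (sigma s))) =
    expi (dotp Q z) * expi (psi s + dotp q (sigma s)) :> C.
  by rewrite -!expiD; congr expi; rewrite /q (pairDr FS) !(pairDl FS) !(pairNl FS); ring.
transitivity (w s * c * ft f q *
  (expi (psi s + dotp (iota s) z) * expi (dotp q (add z (sigma s))))); first by ring.
by rewrite phaseE; ring.
Qed.

Lemma cintegrable_twist_double z : cintegrable (prod_measure mu nu) (fun t =>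
  w t.2 * ft f t.1 *
  expi (psi t.2 + dotp (iota t.2) z + dotp t.1 (add z (sigma t.2)))).
Proof.
(* The integrability lemma is applied with constant displacement [z] to a function already shifted
   by [opp z]; the two shifts cancel and leave the plain product of [w] and [ft f]. *)
have Ig : cintegrable mu (fun q => ft f (add q (opp z))).
  exact: (cintegrable_shift (opp z) Ift).
have mu' : cmeasurable (fun t : T * S =>
    expi (psi t.2 + (dotp (iota t.2) z + dotp t.1 (add z (sigma t.2))))).
  apply: measurable_phase; apply: measurable_funD.
    exact: (measurable_pair_comp (measurableT_comp miota measurable_snd) (measurable_cst z)).
  apply: measurable_pair_comp; first exact: measurable_fst.
  exact: (measurable_add_comp (measurable_cst z) (measurableT_comp msigma measurable_snd)).
have := cintegrable_prod_shift Iw Ig (measurable_cst z) mu' (fun=> norm1_expi _).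
by under eq_fun do rewrite (addvK FS) mulrC addrA.
Qed.

(** Inserting the inversion formula of [f] yields the double Fourier integral by which the star
    products are defined. *)
Lemma twist_double_integral z : twist z = c * cintegral (prod_measure nu mu)
  (fun t => w t.1 * ft f t.2 *
     expi (psi t.1 + dotp (iota t.1) z + dotp t.2 (add z (sigma t.1)))).
Proof.
have IF := cintegrable_swap (cintegrable_twist_double z).
rewrite -cintegralZ// cfubini1; last exact: cintegrableZ.
case: repf => _ _ fE; apply: eq_cintegral => s /=; rewrite fE.
have Ig := cintegrable_ft_expi (measurable_pairl (add z (sigma s))).
rewrite mulrA -cintegralZ//; apply: eq_cintegral => q.
by rewrite (expiD (psi s + _)); ring.
Qed.

End twist.

Section scaled_twist.
Context {R : realType}.
Local Notation C := R[i].
Context d (T : measurableType d) (mu : {sigma_finite_measure set T -> \bar R}).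
Variables (add : T -> T -> T) (opp : T -> T) (dotp : T -> T -> R).
Hypothesis FS : fourier_space mu add opp dotp.
Context d' (S : measurableType d') (nu : {sigma_finite_measure set S -> \bar R}).
Variables (c a : C) (f : T -> C) (w : S -> C).
Variables (psi : S -> R) (iota sigma : S -> T).
Hypotheses (repf : representable mu dotp c f) (Iw : cintegrable nu w).
Hypotheses (mpsi : measurable_fun setT psi) (miota : measurable_fun setT iota)
  (msigma : measurable_fun setT sigma).

(** Here [a] is the inversion constant of the factor providing the weight, so that [c * a] becomes
    the normalisation of the product. *)
Lemma scaled_twist_double_integral z :
  twist add dotp nu f (fun s => a * w s) psi iota sigma z =
  c * a * cintegral (prod_measure nu mu)
  (fun t => w t.1 * ft mu dotp f t.2 *
     expi (psi t.1 + dotp (iota t.1) z + dotp t.2 (add z (sigma t.1)))).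
Proof.
rewrite (twist_double_integral FS repf (cintegrableZ a Iw) mpsi miota msigma).
rewrite -mulrA -(cintegralZ a); last first.
  exact: (cintegrable_swap (cintegrable_twist_double FS repf Iw mpsi miota msigma z)).
by congr (_ * _); apply: eq_cintegral => t; rewrite !mulrA.
Qed.

Lemma scaled_twist_double_integralC z :
  twist add dotp nu f (fun s => a * w s) psi iota sigma z =
  c * a * cintegral (prod_measure mu nu)
  (fun t => w t.2 * ft mu dotp f t.1 *
     expi (psi t.2 + dotp (iota t.2) z + dotp t.1 (add z (sigma t.2)))).
Proof.
rewrite scaled_twist_double_integral; congr (_ * _).
by rewrite (cintegral_prodC (cintegrable_twist_double FS repf Iw mpsi miota msigma z)).
Qed.

End scaled_twist.

(** * Lebesgue measure under affine maps *)

Section lebesgue_affine.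
Context {R : realType}.
Local Open Scope ereal_scope.

(** The image of Lebesgue measure under the affine map, scaled by $|a|$, agrees with Lebesgue
    measure on half-open intervals, hence equals it by uniqueness. *)
Lemma ge0_integral_affine1 (a b : R) (f : measurableTypeR R -> \bar R) :
  a != 0%R -> measurable_fun setT f -> (forall t, 0 <= f t) ->
  \int[lebesgue_measure]_t f t =
  `|a|%:E * \int[lebesgue_measure]_t f (a * t + b)%R.
Proof.
move=> a0 mf f0.
pose phi (t : measurableTypeR R) : measurableTypeR R := (a * t + b)%R.
have mphi : measurable_fun setT phi.
  by apply: measurable_funD => //; exact: measurable_funM.
(* The image measure is obtained as a bundled measure known through its values. *)
have [pf pfE] : exists m : {measure set (measurableTypeR R) -> \bar R},
    forall A, m A = lebesgue_measure (phi @^-1` A).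
  by unshelve eexists (pushforward lebesgue_measure phi).
pose mu := mscale (NngNum (normr_ge0 a)) pf.
have muE A : measurable A -> lebesgue_measure A = mu A.
  move=> mA; apply: lebesgue_measure_unique => //= _ [[c d]] _ <-.
  rewrite /mu /mscale pfE /=.
  have [agt0|alt0|/eqP] := ltgtP a 0%R; last by rewrite (negbTE a0).
  (* A negative slope reverses the interval, so its closed end moves to the left; its length is
     unaffected. *)
  - rewrite (_ : _ @^-1` _ = [set` `[((d - b) / a)%R, ((c - b) / a)%R[]); last first.
      apply/seteqP; split => t; rewrite /= !in_itv /= /phi.
        by move=> /andP[ct td]; rewrite ler_ndivrMr// ltr_ndivlMr//; lra.
      by rewrite ler_ndivrMr// ltr_ndivlMr// => /andP[ct td]; lra.
    rewrite !lebesgue_measure_itv/= !lte_fin ltr_nM2r ?invr_lt0// ltrD2r.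
    case: ifP => _; last by rewrite mule0.
    by rewrite ltr0_norm// -!EFinB -EFinM; congr EFin; field.
  - rewrite (_ : _ @^-1` _ = [set` `]((c - b) / a)%R, ((d - b) / a)%R]]); last first.
      apply/seteqP; split => t; rewrite /= !in_itv /= /phi.
        by move=> /andP[ct td]; rewrite ltr_pdivrMr// ler_pdivlMr//; lra.
      by rewrite ltr_pdivrMr// ler_pdivlMr// => /andP[ct td]; lra.
    rewrite !lebesgue_measure_itv/= !lte_fin ltr_pM2r ?invr_gt0// ltrD2r.
    case: ifP => _; last by rewrite mule0.
    by rewrite gtr0_norm// -!EFinB -EFinM; congr EFin; field.
rewrite (eq_measure_integral mu); last by move=> A mA _; exact: muE.
rewrite ge0_integral_mscale//=; congr (_ * _).
rewrite (eq_measure_integral (pushforward lebesgue_measure phi)); last first.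
  by move=> A mA _; rewrite pfE.
by rewrite ge0_integral_pushforward.
Qed.

Definition vaxpy n (a : R) (x b : vec R n) : vec R n :=
  [tuple (a * tnth x i + tnth b i)%R | i < n].

Lemma measurable_vaxpy n (a : R) d (T : measurableType d) (f g : T -> vec R n) :
  measurable_fun setT f -> measurable_fun setT g ->
  measurable_fun setT (fun x => vaxpy a (f x) (g x)).
Proof.
move=> /measurable_fun_tnthP mf /measurable_fun_tnthP mg.
apply/measurable_fun_tnthP => i.
rewrite (_ : _ \o _ = fun x => (a * tnth (f x) i + tnth (g x) i)%R); last first.
  by apply/funext => x /=; rewrite tnth_mktuple.
by apply: measurable_funD; [apply: measurable_funM => //; exact: mf|exact: mg].
Qed.

Lemma ge0_integral_cons n (f : vec R n.+1 -> \bar R) :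
  measurable_fun setT f -> (forall t, 0 <= f t) ->
  \int[lebesgue_vec n.+1]_t f t =
  \int[lebesgue_measure]_h \int[lebesgue_vec n]_t f [tuple of h :: t].
Proof.
move=> mf f0; rewrite /= /cons_measure.
have mc : measurable_fun setT (fun z : measurableTypeR R * vec R n => [tuple of z.1 :: z.2]).
  exact: measurable_cons.
rewrite ge0_integral_pushforward//=.
rewrite (fubini_tonelli1 (fun z : measurableTypeR R * vec R n => f [tuple of z.1 :: z.2]))//.
exact: measurableT_comp mf mc.
Qed.

(** Induction on the dimension: Tonelli separates the first coordinate, and each coordinate
    contributes one factor $|a|$. *)
Lemma ge0_integral_affine n (a : R) (b : vec R n) (f : vec R n -> \bar R) :
  a != 0%R -> measurable_fun setT f -> (forall t, 0 <= f t) ->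
  \int[lebesgue_vec n]_t f t =
  (`|a| ^+ n)%:E * \int[lebesgue_vec n]_t f (vaxpy a t b).
Proof.
move=> a0; elim: n b f => [|n IH] b f mf f0.
  (* In dimension 0 the measure is the Dirac mass at the empty tuple, the only point. *)
  rewrite expr0 mul1e /= !integral_dirac//= ?diracT ?mul1e; last first.
    by apply: (measurableT_comp mf); exact: measurable_vaxpy.
  by congr f; rewrite [RHS]tuple0.
rewrite (ge0_integral_cons mf f0) ge0_integral_cons//; last first.
  by apply: (measurableT_comp mf); exact: measurable_vaxpy.
have mcons h : measurable_fun setT (fun t : vec R n => f [tuple of h :: t]).
  by apply: (measurableT_comp mf); exact: measurable_cons.
pose b' : vec R n := [tuple of behead b].
under eq_integral do rewrite (IH b')//.
have mff : measurable_fun setT (fun z : measurableTypeR R * vec R n =>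
    f [tuple of z.1 :: vaxpy a z.2 b']).
  apply: (measurableT_comp mf); apply: measurable_cons => //.
  exact: measurable_vaxpy.
pose F h := \int[lebesgue_vec n]_t f [tuple of h :: vaxpy a t b'].
have mF : measurable_fun setT F.
  exact: (@measurable_fun_fubini_tonelli_F _ _ _ _ _ (lebesgue_vec n) _ mff).
rewrite ge0_integralZl//; last by move=> h _; exact: integral_ge0.
rewrite (@ge0_integral_affine1 a (tnth b ord0) F)//; last by move=> h; exact: integral_ge0.
rewrite muleA -EFinM -exprSr; congr (_ * _).
apply: eq_integral => h _; apply: eq_integral => t _; congr f.
apply: eq_from_tnth => i; rewrite tnth_mktuple.
case: (unliftP ord0 i) => [j ->|->]; last by rewrite !tnth0.
rewrite !tnthS tnth_mktuple; congr (_ + _)%R.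
by rewrite tnth_behead; congr tnth; apply: val_inj => /=; rewrite inordK// ltnS.
Qed.

End lebesgue_affine.

(** * Positions and phase space as Fourier spaces *)

Section vector_space.
Context {R : realType} {n : nat}.
Local Notation V := (vec R n).

Definition vopp (k : V) : V := [tuple - tnth k i | i < n].
Definition padd (z a : phase R n) : phase R n := (vadd z.1 a.1, vadd z.2 a.2).
Definition popp (z : phase R n) : phase R n := (vopp z.1, vopp z.2).
Definition pdot (q z : phase R n) : R := dot q.1 z.1 + dot q.2 z.2.

Lemma vaddE k l i : tnth (@vadd R n k l) i = tnth k i + tnth l i.
Proof. by rewrite tnth_mktuple. Qed.

Lemma voppE k i : tnth (vopp k) i = - tnth k i.
Proof. by rewrite tnth_mktuple. Qed.

Lemma vaxpyE a k l i : tnth (@vaxpy R n a k l) i = a * tnth k i + tnth l i.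
Proof. by rewrite tnth_mktuple. Qed.

Lemma dotC (k l : V) : dot k l = dot l k.
Proof. by apply: eq_bigr => i _; rewrite mulrC. Qed.

Lemma dotDl (k l x : V) : dot (vadd k l) x = dot k x + dot l x.
Proof. by rewrite /dot -big_split /=; apply: eq_bigr => i _; rewrite vaddE mulrDl. Qed.

Lemma dotDr (x k l : V) : dot x (vadd k l) = dot x k + dot x l.
Proof. by rewrite dotC dotDl !(dotC x). Qed.

Lemma dotNl (k x : V) : dot (vopp k) x = - dot k x.
Proof. by rewrite /dot -sumrN; apply: eq_bigr => i _; rewrite voppE mulNr. Qed.

Lemma dot_vaxpyl a (k l x : V) : dot (vaxpy a k l) x = a * dot k x + dot l x.
Proof.
rewrite /dot mulr_sumr -big_split /=; apply: eq_bigr => i _.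
by rewrite vaxpyE mulrDl mulrA.
Qed.

Lemma dot_vaxpyr a (k l x : V) : dot x (vaxpy a k l) = a * dot x k + dot x l.
Proof. by rewrite dotC dot_vaxpyl !(dotC x). Qed.

Lemma dot0l (x : V) : dot vec0 x = 0.
Proof. by rewrite /dot big1// => i _; rewrite tnth_mktuple mul0r. Qed.

Lemma dot0r (x : V) : dot x vec0 = 0.
Proof. by rewrite dotC dot0l. Qed.

Definition dotE := (dotDl, dotDr, dotNl, dot_vaxpyl, dot_vaxpyr, dot0l, dot0r).

Lemma measurable_dot d (T : measurableType d) (f g : T -> V) :
  measurable_fun setT f -> measurable_fun setT g ->
  measurable_fun setT (fun x => dot (f x) (g x)).
Proof.
move=> /measurable_fun_tnthP mf /measurable_fun_tnthP mg.
apply: measurable_sum => i.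
by apply: measurable_funM; [exact: mf|exact: mg].
Qed.

Lemma measurable_vadd d (T : measurableType d) (f g : T -> V) :
  measurable_fun setT f -> measurable_fun setT g ->
  measurable_fun setT (fun x => vadd (f x) (g x)).
Proof.
move=> mf mg.
rewrite (_ : (fun _ => _) = fun x => vaxpy 1 (f x) (g x)).
  exact: measurable_vaxpy.
by apply/funext => x; apply: eq_from_tnth => i; rewrite vaddE vaxpyE mul1r.
Qed.

Lemma measurable_vopp : measurable_fun setT (vopp : V -> V).
Proof.
apply/measurable_fun_tnthP => i.
rewrite (_ : _ \o _ = fun x => - tnth x i); last first.
  by apply/funext => x /=; rewrite voppE.
by apply: measurable_funN; exact: measurable_tnth.
Qed.

Lemma fourier_space_vec :
  fourier_space (@lebesgue_vec R n) vadd vopp (@dot R n).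
Proof.
split.
- by apply: measurable_vadd; [exact: measurable_fst|exact: measurable_snd].
- exact: measurable_vopp.
- by apply: measurable_dot; [exact: measurable_fst|exact: measurable_snd].
- by move=> z a; apply: eq_from_tnth => i; rewrite !vaddE voppE addrK.
- exact: dotDl.
- by move=> q z a; rewrite dotDr.
- exact: dotNl.
- move=> a f mf f0.
  (* A translation is the affine map of slope 1, whose Jacobian is 1. *)
  rewrite [RHS](@ge0_integral_affine R n 1 a)// ?oner_eq0//.
  rewrite normr1 expr1n mul1e; apply: eq_integral => t _; congr f.
  by apply: eq_from_tnth => i; rewrite vaddE vaxpyE mul1r.
Qed.

Lemma fourier_space_phase :
  fourier_space (prod_measure (@lebesgue_vec R n) (@lebesgue_vec R n))
    padd popp pdot.
Proof.
have FS := fourier_space_vec.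
have m1 d (T : measurableType d) (f : T -> phase R n) :
    measurable_fun setT f -> measurable_fun setT (fun t => (f t).1).
  by move=> mf; exact: (measurableT_comp measurable_fst mf).
have m2 d (T : measurableType d) (f : T -> phase R n) :
    measurable_fun setT f -> measurable_fun setT (fun t => (f t).2).
  by move=> mf; exact: (measurableT_comp measurable_snd mf).
split.
- by apply: measurable_fun_pair; apply: measurable_vadd;
    [apply: m1|apply: m1|apply: m2|apply: m2];
    [exact: measurable_fst|exact: measurable_snd|exact: measurable_fst|exact: measurable_snd].
- by apply: measurable_fun_pair; apply: (measurableT_comp measurable_vopp).
- by apply: measurable_funD; apply: measurable_dot;
    [apply: m1|apply: m1|apply: m2|apply: m2];
    [exact: measurable_fst|exact: measurable_snd|exact: measurable_fst|exact: measurable_snd].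
- by move=> [z1 z2] [a1 a2]; congr pair; exact: (addvK FS).
- by move=> q r z; rewrite /pdot !dotDl addrACA.
- by move=> q r z; rewrite /pdot !dotDr addrACA.
- by move=> q z; rewrite /pdot !dotNl opprD.
- move=> a f mf f0.
  have mfa : measurable_fun setT (fun t => f (padd t a)).
    apply: (measurableT_comp (g := padd^~ a) mf).
    apply: (@measurable_fun_pair _ _ _ _ _ _ (fun t => vadd t.1 a.1) (fun t => vadd t.2 a.2));
      apply: measurable_vadd => //.
  rewrite (fubini_tonelli1 _ mfa)// (fubini_tonelli1 _ mf)//.
  have mF := measurable_fun_fubini_tonelli_F f mf f0 (m2 := @lebesgue_vec R n).
  (* The position is translated in the outer integral, then the momentum in the inner one. *)
  rewrite -(ge0_integral_shift FS a.1 mF); last by move=> x; exact: integral_ge0.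
  apply: eq_integral => x _; rewrite /fubini_F /padd /=.
  apply: (ge0_integral_shift FS a.2 (f := fun y => f (vadd x a.1, y))) => //.
  exact: (measurableT_comp mf (pair1_measurable _)).
Qed.

End vector_space.

(** * The star products as superpositions of translates *)

Section star_twist.
Context {R : realType} {n : nat}.
Local Notation C := R[i].
Local Notation V := (vec R n).
Local Notation P := (phase R n).
Local Notation dx := (@lebesgue_vec R n).
Local Notation dxp := (prod_measure (@lebesgue_vec R n) (@lebesgue_vec R n)).
Local Notation FSV := (@fourier_space_vec R n).
Local Notation FSP := (@fourier_space_phase R n).
Variables (hbar : R) (theta : 'M[R]_n).

(** This is $M^T k$. For [theta] it represents the linear form $\theta(k, \cdot)$, for the transpose
    $\theta(\cdot, k)$, so a $\theta$-phase can be absorbed into a displacement. *)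
Definition theta_vec (M : 'M[R]_n) (k : V) : V :=
  [tuple \sum_(i < n) M i j * tnth k i | j < n].

Lemma dot_theta_vec k l : dot l (theta_vec theta k) = thetaf theta k l.
Proof.
rewrite /thetaf exchange_big /=; apply: eq_bigr => j _.
by rewrite tnth_mktuple mulr_sumr; apply: eq_bigr => i _; rewrite mulrC.
Qed.

Lemma dot_theta_vec_tr k l : dot k (theta_vec theta^T l) = thetaf theta k l.
Proof.
apply: eq_bigr => i _; rewrite tnth_mktuple mulr_sumr.
by apply: eq_bigr => j _; rewrite mxE mulrCA mulrA.
Qed.

Lemma measurable_theta_vec M : measurable_fun setT (theta_vec M).
Proof.
apply/measurable_fun_tnthP => j.
rewrite (_ : _ \o _ = fun k => \sum_(i < n) M i j * tnth k i); last first.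
  by apply/funext => x /=; rewrite tnth_mktuple.
apply: measurable_sum => i; apply: measurable_funM => //.
exact: measurable_tnth.
Qed.

Lemma fourierE (A : P -> C) : fourier A = ft dxp pdot A.
Proof.
by apply/funext => q; apply: eq_cintegral => z; rewrite /pdot opprD.
Qed.

Lemma fourier_representableE (A : P -> C) :
  fourier_representable A = representable dxp pdot (fnorm (2 * n)%N) A.
Proof. by rewrite /fourier_representable fourierE. Qed.

Lemma fnormD a b : fnorm (a + b) = fnorm a * fnorm b :> C.
Proof. by rewrite /fnorm exprD invfM. Qed.

Lemma fnorm_3n : fnorm n * fnorm (2 * n) = fnorm (3 * n) :> C.
Proof. by rewrite -fnormD -mulSn. Qed.

(** Bopp shift caused by left multiplication with the wave of frequency [q]. The star product takes
    $a = \hbar/2$ and $b = -\hbar/2$. The Weyl action takes $a = \hbar$, because $e^{\hbar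
    l\cdot\partial}$ translates by all of $\hbar l$. *)
Definition star_shift (a b : R) (q : P) : P :=
  (vaxpy a q.2 (vaxpy (- (1 / 2)) (theta_vec theta q.1) vec0),
   vaxpy b q.1 vec0).
(** Bopp shift caused by right multiplication with $e^{ik\cdot x}$, whence the transposed matrix and
    the opposite sign of the momentum displacement. *)
Definition star_x_shift (k : V) : P :=
  (vaxpy (- (1 / 2)) (theta_vec theta^T k) vec0, vaxpy (hbar / 2) k vec0).

Lemma measurable_star_shift a b : measurable_fun setT (star_shift a b).
Proof.
apply: measurable_fun_pair; apply: measurable_vaxpy => //.
by apply: measurable_vaxpy => //; exact: (measurableT_comp (measurable_theta_vec _)).
Qed.

Lemma measurable_star_x_shift : measurable_fun setT star_x_shift.
Proof.
apply: measurable_fun_pair; apply: measurable_vaxpy => //.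
exact: measurable_theta_vec.
Qed.

Definition weight (A : P -> C) q : C := fnorm (2 * n) * fourier A q.

Lemma cintegrable_weight A : cintegrable dxp (fourier A) -> cintegrable dxp (weight A).
Proof. exact: cintegrableZ. Qed.

(** With a single exponent, comparing phases becomes a ring identity. *)
Lemma wave_starE q q' (z : P) : wave_star hbar theta q q' z =
  expi (- (hbar / 2) * (dot q.1 q'.2 - dot q'.1 q.2) - 1 / 2 * thetaf theta q.1 q'.1 +
    (dot q.1 z.1 + dot q'.1 z.1 + dot q.2 z.2 + dot q'.2 z.2)).
Proof.
rewrite /wave_star /wave -!expiD /= !dotDl; congr expi; ring.
Qed.

Lemma star_twist A1 A2 : cintegrable dxp (fourier A1) -> fourier_representable A2 ->
  star hbar theta A1 A2 = twist padd pdot dxp A2 (weight A1) (fun=> 0) id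
    (star_shift (hbar / 2) (- (hbar / 2))).
Proof.
rewrite fourier_representableE => I1 rep2; apply/funext => z.
rewrite (scaled_twist_double_integral FSP _ rep2 I1)//; last first.
  exact: measurable_star_shift.
rewrite -fnormD -mulnDl; congr (_ * _); apply: eq_cintegral => -[q q'] /=.
rewrite -fourierE; congr (_ * _); rewrite wave_starE; congr expi.
rewrite /pdot /padd /star_shift /= !dotE dot_theta_vec.
by rewrite (dotC q'.2 q.1); ring.
Qed.

(* Here the waves of B translate A, which controls the product on phase space.
   In star_x_twist the waves of A translate B: this makes the product integrable
   in x for every p, not just for almost every p. *)
Lemma star_x_twist_phase A B : fourier_representable A ->
  cintegrable dx (fourier_x B) ->
  star_x hbar theta A B = twist padd pdot dx A (fun k => fnorm n * fourier_x B k) (fun=> 0)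
    (fun k => (k, vec0)) star_x_shift.
Proof.
rewrite fourier_representableE => rep IB; apply/funext => z.
rewrite (scaled_twist_double_integralC FSP _ rep IB)//; last first.
  exact: measurable_star_x_shift.
rewrite (mulrC (fnorm _)) fnorm_3n; congr (_ * _); apply: eq_cintegral => -[q k] /=.
rewrite -fourierE (mulrC (fourier_x _ _)); congr (_ * _).
rewrite wave_starE; congr expi.
rewrite /pdot /padd /star_x_shift /= !dotE dot_theta_vec_tr.
by rewrite (dotC q.2 k); ring.
Qed.

(** With [p] frozen, the momentum part of a wave of [A] is a constant phase, and the displacement
    acts on positions. *)
Lemma star_x_twist A B x p : cintegrable dxp (fourier A) ->
  fourier_representable_x B ->
  star_x hbar theta A B (x, p) = twist (@vadd R n) (@dot R n) dxp B (weight A)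
    (fun q => dot q.2 p) fst (fun q => (star_shift (hbar / 2) 0 q).1) x.
Proof.
move=> IA repB.
rewrite (scaled_twist_double_integral FSV _ repB IA)//; last 2 first.
- exact: measurable_dot.
- exact: (measurableT_comp measurable_fst (measurable_star_shift _ _)).
rewrite fnorm_3n; congr (_ * _); apply: eq_cintegral => -[q k] /=.
congr (_ * _); rewrite wave_starE; congr expi.
rewrite /star_shift /= !dotE dot_theta_vec.
ring.
Qed.

(** In $e^{i\hbar l\cdot(k' + k/2)}$ the term in $k'$ is the displacement $\hbar l$ of [B]; the term
    in $k$ is the Weyl ordering phase. *)
Lemma weyl_star_twist A B : cintegrable dxp (fourier A) ->
  fourier_representable_x B ->
  weyl_star hbar theta A B = twist (@vadd R n) (@dot R n) dxp B (weight A)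
    (fun q => hbar / 2 * dot q.2 q.1) fst (fun q => (star_shift hbar 0 q).1).
Proof.
move=> IA repB; apply/funext => x.
rewrite (scaled_twist_double_integral FSV _ repB IA)//; last 2 first.
- by apply: measurable_funM => //; exact: measurable_dot.
- exact: (measurableT_comp measurable_fst (measurable_star_shift _ _)).
rewrite fnorm_3n; congr (_ * _); apply: eq_cintegral => -[q k] /=.
rewrite -!mulrA; congr (_ * (_ * _)); rewrite /wave_x -!expiD; congr expi.
rewrite /star_shift /= !dotE dot_theta_vec.
by rewrite (dotC q.2 k); ring.
Qed.

End star_twist.

(** * Affine substitution in complex integrals *)

Section affine_substitution.
Context {R : realType} {n : nat}.
Local Notation C := R[i].
Local Notation V := (vec R n).
Local Notation dx := (@lebesgue_vec R n).
Variables (a : R) (b : V).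
Hypothesis a0 : a != 0.

Let norm_a : (0 < (`|a| ^+ n)%:E)%E.
Proof. by rewrite lte_fin exprn_gt0// normr_gt0. Qed.

Let affine := fun t : V => vaxpy a t b.

Let Rintegral_affine (g : V -> R) : dx.-integrable setT (fun t => (g t)%:E) ->
  \int[dx]_t g t = `|a| ^+ n * \int[dx]_t g (affine t).
Proof.
move=> Ig; have mg := measurable_int _ Ig.
have mp := measurable_funepos mg; have mn := measurable_funeneg mg.
have Ep := ge0_integral_affine b a0 mp (fun t => funepos_ge0 _ t).
have En := ge0_integral_affine b a0 mn (fun t => funeneg_ge0 _ t).
have Fp := integrable_pos_fin_num measurableT Ig.
have Fn := integrable_neg_fin_num measurableT Ig.
(* An infinite integral after substitution would, times the positive Jacobian, make the original one
   infinite. Finiteness of both parts lets the factor distribute over their difference. *)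
have fin_comp (h : V -> \bar R) : (forall t, 0 <= h t)%E ->
    (\int[dx]_t h t)%E \is a fin_num ->
    (\int[dx]_t h t = (`|a| ^+ n)%:E * \int[dx]_t h (affine t))%E ->
    (\int[dx]_t h (affine t))%E \is a fin_num.
  move=> h0 hfin hE; rewrite ge0_fin_numE ?integral_ge0// ltNge.
  apply/negP; rewrite leye_eq => /eqP hy.
  by move: hfin; rewrite hE hy gt0_muley.
rewrite /Rintegral integralE [in RHS]integralE.
under [in RHS]eq_integral do rewrite (funepos_comp (EFin \o g) affine).
under [X in _ = _ * fine (_ - X)%E]eq_integral do rewrite (funeneg_comp (EFin \o g) affine).
have {Fp} := fin_comp _ (fun t => funepos_ge0 _ t) Fp Ep.
have {Fn} := fin_comp _ (fun t => funeneg_ge0 _ t) Fn En.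
rewrite Ep En /comp /affine.
move: (\int[dx]_t _)%E (\int[dx]_t _)%E => [x| |] [y| |]// _ _.
by rewrite /= mulrBr.
Qed.

Lemma cintegral_affine (f : V -> C) : cintegrable dx f ->
  cintegral dx f =
  real_complex R (`|a| ^+ n) * cintegral dx (fun t => f (vaxpy a t b)).
Proof.
move=> [Ir Ii]; rewrite /cintegral (Rintegral_affine Ir) (Rintegral_affine Ii).
by rewrite /real_complex_def /=; congr Complex; rewrite mul0r ?subr0 ?addr0.
Qed.

Lemma eq_cintegral_affine (f g : V -> C) :
  cintegrable dx f -> cintegrable dx g -> cintegral dx f = cintegral dx g ->
  cintegral dx (fun t => f (vaxpy a t b)) = cintegral dx (fun t => g (vaxpy a t b)).
Proof.
move=> If Ig; rewrite cintegral_affine// (cintegral_affine Ig); apply: mulfI.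
by rewrite fmorph_eq0 expf_neq0// normr_eq0.
Qed.

End affine_substitution.

(** * Representability and composition of the products *)

Section products.
Context {R : realType} {n : nat}.
Local Notation C := R[i].
Local Notation V := (vec R n).
Local Notation P := (phase R n).
Local Notation dx := (@lebesgue_vec R n).
Local Notation dxp := (prod_measure (@lebesgue_vec R n) (@lebesgue_vec R n)).
Local Notation FSV := (@fourier_space_vec R n).
Local Notation FSP := (@fourier_space_phase R n).
Variables (hbar : R) (theta : 'M[R]_n).

Lemma star_representable (A1 A2 : P -> C) :
  cintegrable dxp (fourier A1) -> fourier_representable A2 ->
  fourier_representable (star hbar theta A1 A2).
Proof.
move=> I1 rep2; rewrite (star_twist hbar theta I1 rep2) fourier_representableE.
rewrite fourier_representableE in rep2.
by apply: (twist_representable FSP rep2 (cintegrable_weight I1)) => //;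
  exact: measurable_star_shift.
Qed.

Lemma star_x_representable (A : P -> C) (B : V -> C) :
  fourier_representable A -> cintegrable dx (fourier_x B) ->
  fourier_representable (star_x hbar theta A B).
Proof.
move=> rep IB; rewrite (star_x_twist_phase hbar theta rep IB) fourier_representableE.
rewrite fourier_representableE in rep.
by apply: (twist_representable FSP rep (cintegrableZ _ IB)) => //;
  exact: measurable_star_x_shift.
Qed.

Lemma weyl_star_representable (A : P -> C) (B : V -> C) :
  cintegrable dxp (fourier A) -> fourier_representable_x B ->
  fourier_representable_x (weyl_star hbar theta A B).
Proof.
move=> IA repB; rewrite (weyl_star_twist hbar theta IA repB).
apply: (twist_representable FSV repB (cintegrable_weight IA)) => //.
  by apply: measurable_funM => //; exact: measurable_dot.
exact: (measurableT_comp measurable_fst (measurable_star_shift _ _ _)).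
Qed.

(** The phase $-\frac{\hbar}{2} k\cdot y$ moves the evaluation point in the inversion formula of
    [A]; the $\theta$-phase vanishes since $e^{iy\cdot p}$ has zero position frequency. *)
Lemma star_expE (A : P -> C) y z : fourier_representable A ->
  star_exp hbar theta A y z =
  expi (dot y z.2) * A (vaxpy (- (hbar / 2)) y z.1, z.2).
Proof.
rewrite fourier_representableE => -[IA IfA AE]; rewrite AE mulrCA; congr (_ * _).
rewrite -cintegralZ; last first.
  under eq_fun do rewrite mulrC.
  apply: (cintegrable_expi _ IfA).
  by apply: measurable_funD; apply: measurable_dot.
apply: eq_cintegral => q; rewrite [RHS]mulrCA fourierE; congr (_ * _).
rewrite wave_starE -expiD; congr expi.
by rewrite /pdot /= !dotE -dot_theta_vec dot0l; ring.
Qed.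

Lemma star_x_expE (B : V -> C) y z : fourier_representable_x B ->
  star_x_exp hbar theta B y z =
  expi (dot y z.2) * B (vaxpy (- (hbar / 2)) y z.1).
Proof.
move=> [IB IfB BE]; rewrite BE mulrCA; congr (_ * _).
rewrite -cintegralZ; last first.
  under eq_fun do rewrite mulrC.
  by apply: (cintegrable_expi _ IfB); exact: measurable_dot.
apply: eq_cintegral => k; rewrite [RHS]mulrCA; congr (_ * _).
rewrite wave_starE -expiD; congr expi.
by rewrite /= !dotE -dot_theta_vec dot0l; ring.
Qed.

(** The transform of a star product is a twisted convolution of the transforms. *)
Lemma fourier_star (A1 A2 : P -> C) Q : cintegrable dxp (fourier A1) ->
  fourier_representable A2 ->
  fourier (star hbar theta A1 A2) Q = cintegral dxp (fun q =>
    weight A1 q * expi (pdot (padd Q (popp q)) (star_shift theta (hbar / 2) (- (hbar / 2)) q)) *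
    fourier A2 (padd Q (popp q))).
Proof.
move=> I1 rep2; rewrite (star_twist hbar theta I1 rep2) !fourierE.
rewrite fourier_representableE in rep2.
rewrite (ft_twist FSP rep2 (cintegrable_weight I1))//; last exact: measurable_star_shift.
by apply: eq_cintegral => q; rewrite add0r.
Qed.

Lemma theta_vec_vadd (k l : V) :
  theta_vec theta (vadd k l) = vadd (theta_vec theta k) (theta_vec theta l).
Proof.
apply: eq_from_tnth => i; rewrite vaddE !tnth_mktuple -big_split /=.
by apply: eq_bigr => j _; rewrite vaddE mulrDr.
Qed.

(** The twisted convolution is inserted as the weight of the left side; exchanging integrals and
    setting $Q = q' + q$ turns it into the iterated superposition on the right. *)
Lemma weyl_star_assoc (A1 A2 : P -> C) (B : V -> C) :
  cintegrable dxp (fourier A1) -> fourier_representable A2 ->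
  fourier_representable_x B ->
  weyl_star hbar theta (star hbar theta A1 A2) B =
  weyl_star hbar theta A1 (weyl_star hbar theta A2 B).
Proof.
move=> I1 rep2 repB; have [_ I2 _] := rep2.
have [_ I12 _] := star_representable I1 rep2.
rewrite (weyl_star_twist hbar theta I12 repB).
rewrite (weyl_star_twist hbar theta I1 (weyl_star_representable I2 repB)).
rewrite (weyl_star_twist hbar theta I2 repB).
apply/funext => x; rewrite /twist.
have [IB IfB _] := repB; have [M BM] := representable_bounded FSV repB.
have [N AN] : exists N, forall q, norm1 (fourier A2 q) <= N.
  by rewrite fourierE; case: rep2 => IA2 _ _; exact: (ft_bounded FSP IA2).
have mW := measurable_star_shift theta hbar 0.
have mS := measurable_star_shift theta (hbar / 2) (- (hbar / 2)).
(* [T Q] is the Weyl operator of the wave [Q] applied to [B], evaluated at [x]; [E] below is the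
   kernel of the twisted convolution. *)
pose T Q : C := expi (hbar / 2 * dot Q.2 Q.1 + dot Q.1 x) *
  B (vadd x (star_shift theta hbar 0 Q).1).
have mT : cmeasurable T.
  apply: cmeasurableM.
    apply: cmeasurable_expi; apply: measurable_funD; last exact: measurable_dot.
    by apply: measurable_funM => //; exact: measurable_dot.
  apply: (cmeasurable_comp (cintegrable_cmeasurable IB)).
  apply: (measurable_add_comp FSV (measurable_cst x)).
  exact: (measurableT_comp measurable_fst mW).
pose c2 : C := fnorm (2 * n).
pose E Q q : C := expi (pdot (padd Q (popp q))
  (star_shift theta (hbar / 2) (- (hbar / 2)) q)).
have mE : cmeasurable (fun t : P * P => E t.1 t.2).
  apply: cmeasurable_expi; apply: (measurable_pair_comp FSP).
    apply: (measurable_add_comp FSP); first exact: measurable_fst.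
    exact: (measurableT_comp (measurable_opp FSP) measurable_snd).
  exact: (measurableT_comp mS measurable_snd).
(* The transform of [A2] is translated by [popp q] under the weight of [A1]; everything else is
   bounded. *)
have IF : cintegrable (prod_measure dxp dxp) (fun t : P * P =>
    c2 * T t.1 * E t.1 t.2 * (weight A1 t.2 * fourier A2 (padd t.1 (popp t.2)))).
  apply: (cintegrable_prod_shift (M := norm1 c2 * (2 * M) * 2) FSP
    (cintegrable_weight I1) I2 (measurable_opp FSP)) => [|t].
    apply: cmeasurableM => //; apply: cmeasurableM; first exact: cmeasurable_cst.
    exact: (cmeasurable_comp mT measurable_fst).
  apply: le_trans (norm1M _ _) _; rewrite ler_pM ?norm1_ge0 ?norm1_expi//.
  apply: le_trans (norm1M _ _) _; rewrite ler_wpM2l ?norm1_ge0//.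
  by apply: le_trans (norm1M _ _) _; rewrite ler_pM ?norm1_ge0 ?norm1_expi.
transitivity (cintegral dxp (fun Q => cintegral dxp (fun q =>
    c2 * T Q * E Q q * (weight A1 q * fourier A2 (padd Q (popp q)))))).
  apply: eq_cintegral => Q.
  transitivity (c2 * T Q * cintegral dxp (fun q =>
      E Q q * fourier A2 (padd Q (popp q)) * weight A1 q)).
    rewrite {1}/weight fourier_star// /T -!mulrA; congr (_ * _).
    rewrite mulrC !mulrA; congr (_ * _).
    by apply: eq_cintegral => q; rewrite -/(E Q q); ring.
  rewrite -cintegralZ; first by apply: eq_cintegral => q; ring.
  have mQ : measurable_fun setT (fun q : P => padd Q (popp q)).
    exact: (measurable_add_comp FSP (measurable_cst Q) (measurable_opp FSP)).
  apply: (cintegrableMr (M := 2 * N) (cintegrable_weight I1)) => [|q].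
    apply: cmeasurableM.
      exact: cmeasurable_expi (measurable_pair_comp FSP mQ mS).
    exact: (cmeasurable_comp (cintegrable_cmeasurable I2)).
  apply: le_trans (norm1M _ _) _.
  by rewrite ler_pM ?norm1_ge0 ?norm1_expi.
rewrite (cintegral_exchange IF); apply: eq_cintegral => q.
have mFq := cmeasurable_comp (cintegrable_cmeasurable IF) (pair2_measurable q).
rewrite -(cintegral_shift FSP q mFq).
(* The point to which the wave [q] of [A1] moves [x], where the inner action of [A2] is
   evaluated. *)
set y := vadd x (star_shift theta hbar 0 q).1.
rewrite -cintegralZ; last first.
  under eq_fun do rewrite -mulrA mulrC.
  apply: (cintegrableMr (M := 2 * M) (cintegrable_weight I2)) => [|q'].
    apply: cmeasurableM.
      apply: cmeasurable_expi; apply: measurable_funD; last exact: measurable_dot.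
      by apply: measurable_funM => //; exact: measurable_dot.
    apply: (cmeasurable_comp (cintegrable_cmeasurable IB)).
    apply: (measurable_add_comp FSV (measurable_cst y)).
    exact: (measurableT_comp measurable_fst mW).
  apply: le_trans (norm1M _ _) _.
  by rewrite ler_pM ?norm1_ge0 ?norm1_expi.
apply: eq_cintegral => q' /=; rewrite /T /E (addvK FSP).
(* Displacements are linear in the frequency, so successive ones add up. *)
have -> : vadd x (star_shift theta hbar 0 (padd q' q)).1 =
    vadd y (star_shift theta hbar 0 q').1.
  apply: eq_from_tnth => i; rewrite /y /star_shift /= theta_vec_vadd !(vaddE, vaxpyE).
  have -> : tnth (@vec0 R n) i = 0 by rewrite tnth_mktuple.
  by ring.
(* Composition law of the Weyl operators, for $q = (k, l)$ and $q' = (k', l')$: the star phase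
   cancels the cross term $l'\cdot k$ and doubles $k'\cdot l$, which gives the displacement $\hbar
   l$ contained in [y]. *)
have phaseE : expi (hbar / 2 * dot (padd q' q).2 (padd q' q).1 + dot (padd q' q).1 x) *
    expi (pdot q' (star_shift theta (hbar / 2) (- (hbar / 2)) q)) =
    expi (hbar / 2 * dot q.2 q.1 + dot q.1 x) *
    expi (hbar / 2 * dot q'.2 q'.1 + dot q'.1 y) :> C.
  rewrite -!expiD; congr expi; rewrite /y /pdot /padd /star_shift /= !dotE.
  by rewrite (dotC q.2 q'.1); field.
rewrite [LHS](_ : _ = c2 * weight A1 q * fourier A2 q' *
    B (vadd y (star_shift theta hbar 0 q').1) *
  (expi (hbar / 2 * dot (padd q' q).2 (padd q' q).1 + dot (padd q' q).1 x) *
   expi (pdot q' (star_shift theta (hbar / 2) (- (hbar / 2)) q)))); last by ring.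
by rewrite phaseE [weight A2 q']/weight -/c2 /star_shift /=; ring.
Qed.

End products.

(** * Comparison of the two integrals over $y$ *)

Theorem corollary2 (R : realType) (n : nat) (hbar : R) (theta : 'M[R]_n)
    (A1 A2 : phase R n -> R[i]) (B : vec R n -> R[i]) :
  (0 < n)%N -> 0 < hbar -> theta^T = - theta ->
  fourier_representable A1 -> fourier_representable A2 ->
  fourier_representable_x B ->
  forall z : phase R n,
    cintegral (lebesgue_vec n) (fun y : vec R n =>
      star_exp hbar theta
        (star_x hbar theta (star hbar theta A1 A2) B) y z) =
    cintegral (lebesgue_vec n) (fun y : vec R n =>
      star_x_exp hbar theta
        (weyl_star hbar theta A1 (weyl_star hbar theta A2 B)) y z).
Proof.
move=> _ hbar_gt0 _ rep1 rep2 repB [x p].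
have [_ I1 _] := rep1; have [_ IB _] := repB.
set A := star hbar theta A1 A2.
have repA : fourier_representable A by exact: star_representable.
have [_ IA _] := repA.
have repW := weyl_star_representable hbar theta IA repB.
rewrite -weyl_star_assoc//.
under eq_cintegral do
  rewrite (star_expE hbar theta _ _ (star_x_representable hbar theta repA IB))/=.
under [RHS]eq_cintegral do rewrite (star_x_expE hbar theta _ _ repW)/=.
(* The frequency for which $y\cdot p = q\cdot(x - x')$ when $x' = x - \frac{\hbar}{2} y$. *)
pose q := vaxpy (2 / hbar) p vec0.
pose D (x' : vec R n) : R[i] := star_x hbar theta A B (x', p).
pose W := weyl_star hbar theta A B.
have DE : D = twist (@vadd R n) (@dot R n)
    (prod_measure (lebesgue_vec n) (lebesgue_vec n)) B (weight A)
    (fun q => dot q.2 p) fst (fun q => (star_shift theta (hbar / 2) 0 q).1).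
  by rewrite /D; apply/funext => x'; exact: star_x_twist.
have m1 a : measurable_fun setT (fun q => (star_shift theta a 0 q).1).
  exact: (measurableT_comp measurable_fst (measurable_star_shift _ _ _)).
have mp : measurable_fun setT (fun q : phase R n => dot q.2 p).
  exact: measurable_dot.
have mpsi : measurable_fun setT (fun q : phase R n => hbar / 2 * dot q.2 q.1).
  by apply: measurable_funM => //; exact: measurable_dot.
have FSV := @fourier_space_vec R n; have Iw := cintegrable_weight IA.
have ID : cintegrable (lebesgue_vec n) D by rewrite DE; exact: (cintegrable_twist FSV repB Iw).
(* For a wave $(k, l)$ of [A] the phases are $l\cdot p + \frac{\hbar}{2} l\cdot(q - k)$ and
   $\frac{\hbar}{2} l\cdot k + \hbar\, l\cdot(q - k)$, up to the same $\theta$-term; they agree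
   because $\frac{\hbar}{2} q = p$. *)
have ftDW : ft (lebesgue_vec n) (@dot R n) D q = ft (lebesgue_vec n) (@dot R n) W q.
  rewrite DE (ft_twist FSV repB Iw mp measurable_fst (m1 _) q).
  rewrite /W (weyl_star_twist hbar theta IA repB).
  rewrite (ft_twist FSV repB Iw mpsi measurable_fst (m1 _) q).
  apply: eq_cintegral => s; congr (_ * expi _ * _).
  rewrite /star_shift /q /= !dotE (dotC p s.2) (dotC s.2 s.1).
  by field; rewrite gt_eqF.
have hbar2 : - (hbar / 2) != 0 by rewrite oppr_eq0 mulf_neq0 ?invr_neq0 ?gt_eqF.
have waveE (F : vec R n -> R[i]) y :
    expi (dot y p) * F (vaxpy (- (hbar / 2)) y x) =
    expi (dot q x) * (expi (- dot q (vaxpy (- (hbar / 2)) y x)) *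
      F (vaxpy (- (hbar / 2)) y x)).
  rewrite mulrA -expiD; congr (expi _ * _).
  by rewrite /q !dotE (dotC p y); field; rewrite gt_eqF.
have Iexpi F : cintegrable (lebesgue_vec n) F ->
    cintegrable (lebesgue_vec n) (fun x' => expi (- dot q x') * F x').
  by apply: cintegrable_expi; apply: measurable_funN; exact: measurable_dot.
have [IW _ _] := repW.
under eq_cintegral do rewrite (waveE D).
under [RHS]eq_cintegral do rewrite (waveE W).
(* Both sides are pulled back along $y \mapsto x - \frac{\hbar}{2} y$, so the common Jacobian
   cancels and the transforms at [q] remain to be compared. *)
apply: (eq_cintegral_affine x hbar2
  (f := fun x' => expi (dot q x) * (expi (- dot q x') * D x'))
  (g := fun x' => expi (dot q x) * (expi (- dot q x') * W x'))).
- exact/cintegrableZ/Iexpi.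
- exact/cintegrableZ/Iexpi.
- rewrite !cintegralZ; [|exact: Iexpi..].
  exact: (congr1 (fun c => expi (dot q x) * c) ftDW).
Qed.
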